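(* Let $L$ be a bounded distributive meet semi-lattice and let $X=\langle L_*,\tau,\subseteq,L_+\rangle$ be its generalized Priestley space, with $X_0=L_+$. Then the maps $I\mapsto U(I)=\bigcup\{\phi(a):a\in I\}$ and $U\mapsto I(U)=\{a\in L:\phi(a)\subseteq U\}$ are mutually inverse order-isomorphisms between the ordered set (under inclusion) of ideals of $L$ and the ordered set (under inclusion) of open upsets $U$ of $X$ such that $X-U={\downarrow}(X_0-U)$.
   Context: A bounded distributive meet semi-lattice is a poset with top and bottom in which any two elements have a meet $\wedge$, such that $b_1\wedge b_2\le a$ implies $a=c_1\wedge c_2$ for some $c_1\ge b_1$, $c_2\ge b_2$. An ideal of $L$ is a nonempty downset $I$ such that for all $a,b\in I$ there is $c\in I$ with $a\le c$ and $b\le c$. A filter is a nonempty upset closed under $\wedge$; a prime filter is a filter $F\ne L$ such that $F_1\cap F_2\subseteq F$ for filters $F_1,F_2$ implies $F_1\subseteq F$ or $F_2\subseteq F$; $L_+$ is the set of prime filters; $\sigma(a)=\{y\in L_+:a\in y\}$; $D(L)$ is the lattice of finite unions of sets $\sigma(a)$; a filter $G$ is optimal if $G=\sigma^{-1}(P)$ for a prime filter $P$ of $D(L)$; $L_*$ is the set of optimal filters, ordered by $\subseteq$, with $\phi(a)=\{y\in L_*:a\in y\}$ and the topology $\tau$ generated by the subbasis $\{\phi(a)\}\cup\{L_*-\phi(b)\}$. ${\downarrow}A$ denotes the downset generated by $A$ in $L_*$. *)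

(* Defs.v *)
From HB Require Import structures.
From mathcomp Require Import all_boot all_order.
From mathcomp Require Import all_classical topology_structure.

Set Implicit Arguments.
Unset Strict Implicit.
Unset Printing Implicit Defensive.

Import Order.TTheory.
Local Open Scope classical_set_scope.

Section Semilattice.
Context {d : Order.disp_t}.

Definition upset (T : porderType d) (A : set T) : Prop :=
  forall x y, (x <= y)%O -> A x -> A y.

Definition downset (T : porderType d) (A : set T) : Prop :=
  forall x y, (x <= y)%O -> A y -> A x.

Definition ideal (T : porderType d) (I : set T) : Prop :=
  [/\ I !=set0, downset I &
      forall a b, I a -> I b -> exists c, [/\ I c, (a <= c)%O & (b <= c)%O]].

Definition distributive_msl (T : meetSemilatticeType d) : Prop :=
  forall a b1 b2 : T, (b1 `&` b2 <= a)%O ->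
  exists c1 c2, [/\ (b1 <= c1)%O, (b2 <= c2)%O & a = (c1 `&` c2)%O].

Definition mfilter (T : meetSemilatticeType d) (F : set T) : Prop :=
  [/\ F !=set0, upset F & forall a b, F a -> F b -> F (a `&` b)%O].

Definition prime_filter (T : meetSemilatticeType d) (F : set T) : Prop :=
  [/\ mfilter F, F <> setT &
      forall F1 F2, mfilter F1 -> mfilter F2 -> F1 `&` F2 `<=` F ->
        F1 `<=` F \/ F2 `<=` F].

End Semilattice.

Section DL.
Context {d : Order.disp_t} (L : meetSemilatticeType d).

Definition sigma (a : L) : set (set L) := [set y | prime_filter y /\ y a].

Definition sigma_unions : set (set (set L)) :=
  [set A | exists s : seq L, A = \bigcup_(a in [set` s]) sigma a].

Lemma sigmaI a b : sigma a `&` sigma b = sigma (a `&` b)%O.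
Proof.
apply/seteqP; split=> y /=.
  by move=> [[py ya] [_ yb]]; split=> //; case: py => [[_ _ fI] _ _]; apply: fI.
move=> [py yab]; have [[_ up _] _ _] := py.
by split; split=> //; apply: up yab; [exact: leIl | exact: leIr].
Qed.

Lemma sigma_unionsI : {in sigma_unions &, forall A B, (A `&` B)%O \in sigma_unions}.
Proof.
move=> _ _ /set_mem[s ->] /set_mem[t ->]; apply/mem_set.
exists [seq (a `&` b)%O | a <- s, b <- t]; rewrite -[LHS]/(_ `&` _)%classic.
apply/seteqP; split=> y.
  move=> [[a /= sa ya] [b /= tb yb]]; exists (a `&` b)%O.
    by apply/allpairsP; exists (a, b).
  by rewrite -sigmaI.
move=> [c /= /allpairsP[[a b] /= [sa tb ->]]]; rewrite -sigmaI => -[ya yb].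
by split; [exists a | exists b].
Qed.

Lemma sigma_unionsU : {in sigma_unions &, forall A B, (A `|` B)%O \in sigma_unions}.
Proof.
move=> _ _ /set_mem[s ->] /set_mem[t ->]; apply/mem_set.
exists (s ++ t); rewrite -[LHS]/(_ `|` _)%classic -bigcup_setU.
by congr bigcup; apply/seteqP; split=> a /=; rewrite mem_cat => /orP.
Qed.

(* The lattice D(L), with the order, meets and joins of [set (set L)]. *)
Definition DL : Type := set_type sigma_unions.

HB.instance Definition _ := SubChoice.on DL.
HB.instance Definition _ := Order.SubChoice_isSubLattice.Build
  set_display (set (set L)) (mem sigma_unions) set_display DL sigma_unionsI sigma_unionsU.

Lemma sigma_in_unions a : sigma a \in sigma_unions.
Proof.
apply/mem_set; exists [:: a]; apply/seteqP; split=> y.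
  by move=> ya; exists a => //=; rewrite inE.
by move=> [b /=]; rewrite inE => /eqP->.
Qed.

Definition sigmaD (a : L) : DL := SigSub (sigma_in_unions a).

Definition optimal_filter (G : set L) : Prop :=
  mfilter G /\ exists P : set DL, prime_filter P /\ G = sigmaD @^-1` P.

Lemma le_DLE (x y : DL) : (x <= y)%O <-> val x `<=` val y.
Proof. by rewrite -Order.le_val subsetEset. Qed.

(* L_+ is contained in L_*. *)
Lemma prime_filter_optimal (x : set L) : prime_filter x -> optimal_filter x.
Proof.
move=> px; split; first by case: px.
exists [set A : DL | val A x]; split; last first.
  by apply/seteqP; split => [a xa|a []].
have [[[a xa] xup xI] xT xp] := px.
split.
- split; first by exists (sigmaD a).
  + by move=> A B /le_DLE; apply.
  + by move=> A B Ax Bx; split.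
- move=> e; apply: xT; apply/seteqP; split=> // b _.
  by have : [set A : DL | val A x] (sigmaD b) by [rewrite e|] => -[].
- move=> F1 F2 [_ u1 _] [_ u2 _] sF.
  apply: contrapT => /not_orP[/existsNP[A /not_implyP[FA nA]]].
  move=> /existsNP[B /not_implyP[FB nB]].
  have : val (A `|` B)%O x.
    apply: (sF (A `|` B)%O); split; [apply: u1 FA|apply: u2 FB].
      exact: leUl.
    exact: leUr.
  by case.
Qed.

End DL.

Section Space.
Context {d : Order.disp_t} (L : meetSemilatticeType d).

Definition Lstar : Type := set_type (@optimal_filter d L).

HB.instance Definition _ := SubChoice.on Lstar.
HB.instance Definition _ :=
  [SubChoice_isSubPOrder of Lstar by <: with set_display].

Lemma le_LstarE (x y : Lstar) : (x <= y)%O <-> val x `<=` val y.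
Proof. by rewrite -Order.le_val subsetEset. Qed.

Definition phi (a : L) : set Lstar := [set y | val y a].

HB.instance Definition _ := isSubBaseTopological.Build Lstar
  (range phi `|` range (fun b => ~` phi b)) id.

(* L_+ as a subset of L_*; see [prime_filter_optimal]. *)
Definition X0 : set Lstar := [set y | prime_filter (val y)].

Definition admissible_upset (U : set Lstar) : Prop :=
  [/\ open U, upset U & ~` U = down (X0 `\` U)].

Definition U_of (I : set L) : set Lstar := \bigcup_(a in I) phi a.

Definition I_of (U : set Lstar) : set L := [set a | phi a `<=` U].

End Space.

Definition order_isomorphism (S T : Type) (A : set (set S)) (B : set (set T))
    (f : set S -> set T) : Prop :=
  set_bij A B f /\
  forall I J, A I -> A J -> (f I `<=` f J <-> I `<=` J).

(* Main.v *)
Require Import Defs.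
From mathcomp Require Import all_boot all_order.
From mathcomp Require Import all_classical topology_structure.

(** A filter disjoint from an ideal extends, by Zorn and distributivity of the
    filter lattice, to a prime filter disjoint from the ideal; this yields
    [I_of (U_of I) = I] and the condition [~` U = down (X0 `\` U)] for
    [U = U_of I].  Conversely, the patch topology is compact: an ultrafilter on
    [Lstar] has as limit the trace on [L] of the corresponding ultraproduct of
    prime filters of [DL].  Hence if [phi a] leaves an open set [U] for every
    [a] in a filter [F], some point outside [U] contains [F].  Taking [F] to be
    a point of an upset [U] gives [U_of (I_of U) = U]; taking for [F] the common
    upper bounds of [a] and [b], and enlarging the resulting point to a prime
    filter outside [U], gives directedness of [I_of U]. *)

Set Implicit Arguments.
Unset Strict Implicit.
Unset Printing Implicit Defensive.

Import Order.TTheory.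
Local Open Scope classical_set_scope.

(** * The filter lattice and separation by prime filters *)

Section Filters.
Context {d : Order.disp_t} {L : meetSemilatticeType d}.
Implicit Types (F G I : set L) (a b : L).

Lemma mfilter_ge a : mfilter [set b | (a <= b)%O].
Proof.
split; first by exists a => /=.
- by move=> x y xy /= /le_trans; apply.
- by move=> x y /= ax ay; rewrite lexI ax.
Qed.

Lemma mfilterI F G : (exists c, F c /\ G c) -> mfilter F -> mfilter G ->
  mfilter (F `&` G).
Proof.
move=> [c FGc] [_ Fu FI] [_ Gu GI]; split; first by exists c.
- by move=> x y xy [Fx Gx]; split; [exact: Fu xy Fx | exact: Gu xy Gx].
- by move=> x y [Fx Gx] [Fy Gy]; split; [exact: FI | exact: GI].
Qed.

(** For filters, this is the filter generated by [F] and [G] together. *)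
Definition filter_join F G : set L :=
  [set c | exists a b, [/\ F a, G b & (a `&` b <= c)%O]].

Lemma mfilter_join F G : mfilter F -> mfilter G -> mfilter (filter_join F G).
Proof.
move=> [[a Fa] _ FI] [[b Gb] _ GI]; split.
- by exists (a `&` b)%O, a, b.
- by move=> x y xy [u [v [Fu Gv /le_trans uvx]]]; exists u, v; split=> //; apply: uvx.
- move=> x y [u [v [Fu Gv uvx]]] [u' [v' [Fu' Gv' uvy]]].
  exists (u `&` u')%O, (v `&` v')%O; split; [exact: FI | exact: GI |].
  by rewrite meetACA leI2.
Qed.

Lemma sub_filter_joinl F G : mfilter G -> F `<=` filter_join F G.
Proof. by move=> [[b Gb] _ _] a Fa; exists a, b; split=> //; exact: leIl. Qed.

Lemma sub_filter_joinr F G : mfilter F -> G `<=` filter_join F G.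
Proof. by move=> [[a Fa] _ _] b Gb; exists a, b; split=> //; exact: leIr. Qed.

(** Distributivity is used twice: [c] splits as [c1] meet [c2] with [c2] above [b], then [c2] splits
    again with [e2] above both [b] and [b']. So [e2] lies in [G1] and in [G2], while [c1] and [e1]
    lie in [F]. *)
Lemma filter_join_distr F G1 G2 : distributive_msl L ->
  mfilter F -> mfilter G1 -> mfilter G2 ->
  filter_join F G1 `&` filter_join F G2 `<=` filter_join F (G1 `&` G2).
Proof.
move=> distrL [_ Fu FI] [_ G1u _] [_ G2u _] c.
move=> [[a [b [Fa G1b /distrL[c1 [c2 [ac1 bc2 cE]]]]]] [a' [b' [Fa' G2b' abc]]]].
have /distrL[e1 [e2 [ae1 be2 c2E]]] : (a' `&` b' <= c2)%O.
  by apply: le_trans abc _; rewrite cE leIr.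
exists (c1 `&` e1)%O, e2; split.
- by apply: FI; [exact: Fu ac1 Fa | exact: Fu ae1 Fa'].
- split; [apply: G1u G1b | exact: G2u be2 G2b'].
  by apply: le_trans bc2 _; rewrite c2E leIr.
- by rewrite cE c2E meetA.
Qed.

Lemma maximal_disjoint_filter F I : mfilter F -> F `&` I = set0 ->
  exists M, [/\ mfilter M, F `<=` M, M `&` I = set0 &
    forall G, mfilter G -> M `<=` G -> G `&` I = set0 -> G `<=` M].
Proof.
(* [F] is added to every member because the empty chain has an empty union. *)
move=> fF FI0; pose P G := mfilter (F `|` G) /\ (F `|` G) `&` I = set0.
have [|G [[fG GI0] maxG]] := @Zorn_bigcup L P.
  move=> C CP Ctot; have [[a0 Fa0] Fu FI] := fF.
  split; last first.
    apply/seteqP; split=> // x [[Fx|[X CX Xx]] Ix]; first by rewrite -FI0.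
    by have [_ <-] := CP X CX; split=> //; right.
  have inC X z : C X -> (F `|` X) z -> (F `|` \bigcup_(X in C) X) z.
    by move=> CX [Fz|Xz]; [left | right; exists X].
  split; first by exists a0; left.
  - move=> x y xy [Fx|[X CX Xx]]; first by left; apply: Fu xy Fx.
    by have [[_ Xu _] _] := CP X CX; apply: (inC X) => //; apply: Xu xy _; right.
  - move=> x y [Fx|[X CX Xx]] [Fy|[Y CY Yy]].
    + by left; apply: FI.
    + have [[_ _ YI] _] := CP Y CY.
      by apply: (inC Y) => //; apply: YI; [left | right].
    + have [[_ _ XI] _] := CP X CX.
      by apply: (inC X) => //; apply: XI; [right | left].
    + have [[_ _ XI] _] := CP X CX; have [[_ _ YI] _] := CP Y CY.
      have [XY|YX] := Ctot X Y CX CY.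
        by apply: (inC Y) => //; apply: YI; right; [exact: XY |].
      by apply: (inC X) => //; apply: XI; right; [| exact: YX].
exists (F `|` G); split=> // H fH FGH HI0 x Hx; apply: contrapT => nx.
apply: (maxG H); last first.
  have FH : F `<=` H by move=> y Fy; apply: FGH; left.
  by rewrite /P (setUidPr _ _).2.
split; last by move=> HG; apply: nx; right; exact: HG.
by move=> y Gy; apply: FGH; right.
Qed.

(** A filter [M] maximal among those disjoint from [I] is prime. If neither [F1] nor [F2] lies in
    [M], both joins with [M] meet [I], in a common element since [I] is directed; by distributivity
    that element is above a meet of members of [M] and [F1 & F2], hence in [M]. *)
Theorem prime_filter_separation F I : distributive_msl L ->
  mfilter F -> ideal I -> F `&` I = set0 ->
  exists M, [/\ prime_filter M, F `<=` M & M `&` I = set0].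
Proof.
move=> distrL fF [[i0 Ii0] Id Idir] FI0.
have [M [fM FM MI0 maxM]] := maximal_disjoint_filter fF FI0.
exists M; split=> //; split=> // [MT|F1 F2 fF1 fF2 F12M].
  have : (M `&` I) i0 by rewrite MT.
  by rewrite MI0.
(* Otherwise maximality would put the join of [M] and [G], and so [G], inside [M]. *)
have meetsI G : mfilter G -> ~ G `<=` M -> exists2 c, filter_join M G c & I c.
  move=> fG nGM; apply: contrapT => nex; apply: nGM.
  apply: subset_trans (sub_filter_joinr fM) _; apply: maxM.
  - exact: mfilter_join.
  - exact: sub_filter_joinl.
  - by apply/seteqP; split=> // c [jc Ic]; apply: nex; exists c.
apply: contrapT => /not_orP[/(meetsI _ fF1)[c1 j1 I1] /(meetsI _ fF2)[c2 j2 I2]].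
have [c [Ic c1c c2c]] := Idir _ _ I1 I2.
have [_ u1 _] := mfilter_join fM fF1; have [_ u2 _] := mfilter_join fM fF2.
have [m [f [Mm Ff mfc]]] := filter_join_distr distrL fM fF1 fF2
  (conj (u1 _ _ c1c j1) (u2 _ _ c2c j2)).
have [_ Mu MI] := fM.
have : (M `&` I) c by split=> //; apply: Mu mfc _; apply: MI => //; apply: F12M.
by rewrite MI0.
Qed.

End Filters.

(** * Primality in a lattice, tested on binary joins *)

Lemma prime_filterU (d : Order.disp_t) (D : latticeType d) (P : set D) a b :
  prime_filter P -> P (a `|` b)%O -> P a \/ P b.
Proof.
move=> [[_ Pu _] _ Pp] Pab.
have [c /= [ac bc]||] := Pp _ _ (mfilter_ge a) (mfilter_ge b).
- by apply: Pu Pab; rewrite leUx ac bc.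
- by move=> sP; left; apply: sP => /=.
- by move=> sP; right; apply: sP => /=.
Qed.

Lemma prime_filter_joinP (d : Order.disp_t) (D : latticeType d) (P : set D) :
  mfilter P -> P <> setT -> (forall a b, P (a `|` b)%O -> P a \/ P b) ->
  prime_filter P.
Proof.
move=> fP PT PU; split=> // F1 F2 [_ u1 _] [_ u2 _] F12.
apply: contrapT => /not_orP[/existsNP[a /not_implyP[F1a nPa]]].
move=> /existsNP[b /not_implyP[F2b nPb]].
have /PU[] // : P (a `|` b)%O.
by apply: F12; split; [apply: u1 F1a; exact: leUl | apply: u2 F2b; exact: leUr].
Qed.

(** * Compactness of the patch topology and the two maps *)

Section Space.
Context {d : Order.disp_t} {L : tbMeetSemilatticeType d}.
Implicit Types (F I : set L) (U : set (Lstar L)).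

Lemma mfilter_top (F : set L) : mfilter F -> F \top%O.
Proof. by move=> [[a Fa] Fu _]; apply: Fu Fa; exact: lex1. Qed.

Lemma le_sigmaD_top (A : DL L) : (A <= sigmaD \top%O)%O.
Proof.
apply/le_DLE; have /set_mem[s ->] := valP A.
by move=> y [a _ [py _]]; split=> //; apply: mfilter_top; case: py.
Qed.

Lemma sigmaD_bottom_le (A : DL L) : (sigmaD \bot%O <= A)%O.
Proof.
apply/le_DLE => y [[[_ yu _] yT _] y0]; exfalso; apply: yT.
by apply/seteqP; split=> // a _; apply: yu y0; exact: le0x.
Qed.

Lemma prime_filter_sigmaD_bottom (P : set (DL L)) :
  prime_filter P -> ~ P (sigmaD \bot%O).
Proof.
move=> [[_ Pu _] PT _] P0; apply: PT; apply/seteqP; split=> // A _.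
exact: Pu (sigmaD_bottom_le A) P0.
Qed.

Lemma le_sigmaD (a b : L) : (a <= b)%O -> (sigmaD a <= sigmaD b)%O.
Proof.
by move=> ab; apply/le_DLE => y [py ya]; split=> //; case: py => -[_ yu _] _ _; apply: yu ya.
Qed.

Lemma sigmaD_meet (a b : L) : sigmaD (a `&` b)%O = (sigmaD a `&` sigmaD b)%O.
Proof. by apply: val_inj; apply: esym; exact: sigmaI. Qed.

Lemma sigmaD_preimage_optimal (P : set (DL L)) :
  prime_filter P -> optimal_filter (@sigmaD d L @^-1` P).
Proof.
move=> pP; split; last by exists P.
have [[[A PA] Pu PI] _ _] := pP; split.
- by exists \top%O; apply: Pu PA; exact: le_sigmaD_top.
- by move=> x y xy; apply: Pu; exact: le_sigmaD.
- by move=> x y Px Py; rewrite /preimage/= sigmaD_meet; apply: PI.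
Qed.

Lemma Lstar_mfilter (y : Lstar L) : mfilter (val y).
Proof. by have /set_mem[] := valP y. Qed.

Lemma phi_bottom : phi (\bot%O : L) = set0.
Proof.
apply/seteqP; split=> // y; rewrite /phi/=.
have /set_mem[_ [P [pP ->]]] := valP y.
exact: prime_filter_sigmaD_bottom.
Qed.

Lemma phi_homo (a b : L) : (a <= b)%O -> phi a `<=` phi b.
Proof. by move=> ab y; have [_ yu _] := Lstar_mfilter y; exact: yu. Qed.

Lemma open_phi (a : L) : open (phi a).
Proof.
exists [set phi a]; last by rewrite bigcup_set1.
by move=> _ ->; apply: finI_from1; left; exists a.
Qed.

(* The conclusion amounts to convergence of [S] to [y]; the witness is the trace
   of the [S]-ultraproduct of prime filters of [DL] representing the points. *)
Lemma ultrafilter_limit (S : set_system (Lstar L)) : UltraFilter S ->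
  exists y : Lstar L, forall a, val y a <-> S (phi a).
Proof.
move=> uS; have pS := ultra_proper (UltraFilter := uS).
have /choice[p pP] (x : Lstar L) : exists P : set (DL L),
    prime_filter P /\ val x = @sigmaD d L @^-1` P.
  by have /set_mem[_ [P PP]] := valP x; exists P.
pose Q : set (DL L) := [set A | S [set x | p x A]].
have pQ : prime_filter Q.
  apply: prime_filter_joinP.
  - split.
    + exists (sigmaD \top%O); rewrite /Q/=; apply: filterS filterT => x _ /=.
      have [[[[A pA] pu _] _ _] _] := pP x.
      by apply: pu pA; exact: le_sigmaD_top.
    + move=> A B AB; apply: filterS => x /=.
      by have [[[_ pu _] _ _] _] := pP x; exact: pu.
    + move=> A B QA QB; apply: filterS (filterI QA QB) => x /= [pA pB].
      by have [[[_ _ pI] _ _] _] := pP x; exact: pI.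
  - move=> QT; have : Q (sigmaD \bot%O) by rewrite QT.
    move=> /filter_ex[x /=]; apply: prime_filter_sigmaD_bottom.
    by have [] := pP x.
  (* If the points whose filter contains [A] are not [S]-large, their complement is, and there
     primality of each [p x] yields [B]. *)
  - move=> A B QAB; have [|nA] := in_ultra_setVsetC [set x | p x A] uS; first by left.
    right; apply: filterS (filterI QAB nA) => x /= [+ npA].
    by have [px _] := pP x => /(prime_filterU px)[].
exists (SigSub (mem_set (sigmaD_preimage_optimal pQ))) => a.
rewrite /preimage /Q /=; suff -> : [set x | p x (sigmaD a)] = phi a by [].
by apply/seteqP; split=> x /=; rewrite /phi /=; have [_ ->] := pP x.
Qed.

(** It suffices to treat subbasic sets: [phi a] by hypothesis, and complements because an
    ultrafilter contains a set or its complement. *)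
Lemma ultrafilter_open (S : set_system (Lstar L)) (y : Lstar L) U :
  UltraFilter S -> (forall a, val y a <-> S (phi a)) -> open U -> U y -> S U.
Proof.
move=> uS Sy; have pS := ultra_proper (UltraFilter := uS).
move=> [B Bsub <-] [W BW Wy].
suff : S W by apply: filterS => z Wz; exists W.
have [E Esub WE] := Bsub _ BW.
rewrite -WE; apply: filter_bigI => V EV.
have Vy : V y by move: Wy; rewrite -WE; apply.
have /set_mem[] := Esub _ EV.
  by move=> [a _ aV]; move: Vy; rewrite -aV => /Sy.
move=> [b _ bV]; move: Vy; rewrite -bV /phi /= => nyb.
by have [/Sy|] := in_ultra_setVsetC (phi b) uS.
Qed.

(** The sets [B a] are nonempty and form a filter base, as [F] is closed under meets. The limit of
    an ultrafilter refining it contains [F], and avoids [U] because [U] is open. *)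
Lemma open_compactness U F : open U -> mfilter F ->
  (forall a, F a -> ~ phi a `<=` U) -> exists2 y : Lstar L, ~ U y & F `<=` val y.
Proof.
move=> oU [[a0 Fa0] _ FI] nFU.
pose B a : set (Lstar L) := phi a `\` U.
have fB : ProperFilter (filter_from F B).
  apply: filter_from_proper => [|a Fa].
    apply: filter_from_filter; first by exists a0.
    move=> a b Fa Fb; exists (a `&` b)%O; first exact: FI.
    move=> y [yab nUy]; split; split=> //; apply: phi_homo yab.
      exact: leIl.
    exact: leIr.
  by have /existsNP[y /not_implyP[ya nUy]] := nFU a Fa; exists y.
have [S [uS BS]] := ultraFilterLemma fB.
have pS := ultra_proper (UltraFilter := uS).
have SB a : F a -> S (B a) by move=> Fa; apply: BS; exists a.
have [y Sy] := ultrafilter_limit uS.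
exists y => [Uy|a Fa]; last first.
  by apply/Sy; apply: filterS (SB a Fa) => z [].
have /filter_ex[z [[_ nUz] Uz]] : S (B a0 `&` U).
  by apply: filterI (SB _ Fa0) _; exact: ultrafilter_open Uy.
exact: nUz.
Qed.

(** Being outside [U_of I] means that the filter [val y] misses [I], so it extends to a prime filter
    missing [I]. *)
Lemma ideal_separation I (y : Lstar L) : distributive_msl L -> ideal I ->
  ~ U_of I y -> exists z : Lstar L, [/\ X0 z, (y <= z)%O & ~ U_of I z].
Proof.
move=> distrL iI nUy.
have yI0 : val y `&` I = set0.
  by apply/seteqP; split=> // a [ya Ia]; apply: nUy; exists a.
have [M [pM yM MI0]] := prime_filter_separation distrL (Lstar_mfilter y) iI yI0.
exists (SigSub (mem_set (prime_filter_optimal pM))); split=> //.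
  exact/le_LstarE.
by move=> [a Ia Ma]; have : (M `&` I) a by []; rewrite MI0.
Qed.

Lemma upset_U_of I : upset (U_of I).
Proof. by move=> x y /le_LstarE xy [a Ia xa]; exists a => //; exact: xy. Qed.

Lemma U_of_admissible I : distributive_msl L -> ideal I ->
  admissible_upset (U_of I).
Proof.
move=> distrL iI; split; last 1 first.
- apply/seteqP; split=> y.
    by move=> /(ideal_separation distrL iI)[z [X0z yz nUz]]; exists z.
  by move=> [z [[_ nUz] yz]] /(upset_U_of yz).
- by apply: bigcup_open => a _; exact: open_phi.
- exact: upset_U_of.
Qed.

Lemma U_ofK I : distributive_msl L -> ideal I -> I_of (U_of I) = I.
Proof.
move=> distrL iI; apply/seteqP; split=> a; last by move=> Ia y ya; exists a.
move=> aU; apply: contrapT => nIa; have [_ Id _] := iI.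
(* A prime filter extending the principal filter of [a] and missing [I] is a point of [phi a]
   outside [U_of I]. *)
have aI0 : [set b | (a <= b)%O] `&` I = set0.
  by apply/seteqP; split=> // b [ab Ib]; apply: nIa; exact: Id ab Ib.
have [M [pM aM MI0]] := prime_filter_separation distrL (mfilter_ge a) iI aI0.
have [b Ib Mb] : U_of I (SigSub (mem_set (prime_filter_optimal pM))).
  by apply: aU; apply: aM => /=.
by have : (M `&` I) b by []; rewrite MI0.
Qed.

Lemma I_of_ideal U : admissible_upset U -> ideal (I_of U).
Proof.
move=> [oU uU UE]; split.
- by exists \bot%O; rewrite /I_of/= phi_bottom.
- by move=> a b ab Ib; apply: subset_trans Ib; exact: phi_homo.
- move=> a b Ia Ib; apply: contrapT => nex.
  have fab := mfilterI (ex_intro _ \top%O (conj (lex1 a) (lex1 b)))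
    (mfilter_ge a) (mfilter_ge b).
  have [|y nUy aby] := open_compactness oU fab.
    by move=> c [ac bc] cU; apply: nex; exists c.
  (* The point [y] need not be prime as a filter of [L]; the prime [z] above it must contain [a] or
     [b], which forces [z] into [U]. *)
  have [z [[[_ _ pz] nUz] /le_LstarE yz]] : down (@X0 d L `\` U) y by rewrite -UE.
  have [|sz|sz] := pz _ _ (mfilter_ge a) (mfilter_ge b).
  + exact: subset_trans aby yz.
  + by apply: nUz; apply: Ia; apply: sz => /=.
  + by apply: nUz; apply: Ib; apply: sz => /=.
Qed.

Lemma I_ofK U : admissible_upset U -> U_of (I_of U) = U.
Proof.
move=> [oU uU _]; apply/seteqP; split=> x; first by move=> [a aU]; exact: aU.
move=> Ux; apply: contrapT => nUx.
have [|y nUy xy] := open_compactness oU (Lstar_mfilter x).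
  by move=> a xa aU; apply: nUx; exists a.
by apply: nUy; apply: uU Ux; apply/le_LstarE.
Qed.

Lemma U_of_mono I J : I `<=` J -> U_of I `<=` U_of J.
Proof. by move=> IJ y [a Ia ya]; exists a => //; exact: IJ. Qed.

Lemma I_of_mono U V : U `<=` V -> I_of U `<=` I_of V.
Proof. by move=> UV a aU; exact: subset_trans aU UV. Qed.

End Space.

(** Symmetric in the two maps, so that it serves for both directions of the correspondence. *)
Lemma order_isomorphism_inverse (S T : Type) (A : set (set S))
    (B : set (set T)) (f : set S -> set T) (g : set T -> set S) :
  (forall I, A I -> B (f I)) -> (forall U, B U -> A (g U)) ->
  (forall I, A I -> g (f I) = I) -> (forall U, B U -> f (g U) = U) ->
  (forall I J, I `<=` J -> f I `<=` f J) ->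
  (forall U V, U `<=` V -> g U `<=` g V) ->
  order_isomorphism A B f.
Proof.
move=> AB BA fK gK fmono gmono; split; last first.
  move=> I J AI AJ; split=> [fIJ|]; last exact: fmono.
  by rewrite -(fK I) // -(fK J) //; exact: gmono.
split => //.
- move=> I J /set_mem AI /set_mem AJ fIJ.
  by rewrite -(fK I) // fIJ fK.
- by move=> U BU; exists (g U); [exact: BA | exact: gK].
Qed.

Theorem theorem11p4 (d : Order.disp_t) (L : tbMeetSemilatticeType d)
    (distrL : distributive_msl L) :
  [/\ order_isomorphism (@ideal d L) (@admissible_upset d L) (@U_of d L),
      order_isomorphism (@admissible_upset d L) (@ideal d L) (@I_of d L),
      (forall I : set L, ideal I -> I_of (U_of I) = I) &
      (forall U : set (Lstar L), admissible_upset U -> U_of (I_of U) = U)].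
Proof.
have UA (I : set L) : ideal I -> admissible_upset (U_of I).
  exact: U_of_admissible.
have UK (I : set L) : ideal I -> I_of (U_of I) = I by exact: U_ofK.
split=> //; last exact: I_ofK.
- exact: (order_isomorphism_inverse UA I_of_ideal UK I_ofK U_of_mono I_of_mono).
- exact: (order_isomorphism_inverse I_of_ideal UA I_ofK UK I_of_mono U_of_mono).
Qed.
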